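(* Let $F$ be a star forest with $r>1$ components, $p$ vertices and $q=p-r$ edges. Let $t=(p-1)(q-1)+1$ and $\beta(k,l,n)=k\,2^{kl-3}(10k)^{2\alpha(n)^{kl-4}+8\alpha(n)^{kl-5}}$. Then: (1) $\mathrm{gex}(F,n)<(r-1)n+n\cdot\beta(r,2q,n)$ for all $n$; (2) $\mathrm{ex}_e(F,n)\ll n\cdot\beta(r,2tq,n)^3$; (3) $\mathrm{ex}_i(F,n)\ll n\cdot\beta(r,2tq,n)^3$.
   Context: A star forest is a simple graph $F$ whose vertex set is $A\cup B$ with $A<B$ (every element of $A$ smaller than every element of $B$), every vertex of $B$ has degree 1, and every edge joins $A$ and $B$ (so components are stars whose centres precede all leaves). A hypergraph $H=(E_i:i\in I)$ is a finite list of finite nonempty subsets of $\mathbb{N}$; simple if edges are pairwise distinct; $v(H)=|\bigcup_iE_i|$, $e(H)=|I|$, $i(H)=\sum_i|E_i|$. $H$ contains $H'=(E'_i:i\in I')$ ($H\succ H'$) if there exist an increasing injection $\phi:\bigcup H'\to\bigcup H$ and an injection $f:I'\to I$ with $v\in E'_i\Rightarrow\phi(v)\in E_{f(i)}$. $\mathrm{ex}_e(F,n)$ (resp. $\mathrm{ex}_i(F,n)$) is the maximum of $e(H)$ (resp. $i(H)$) over simple hypergraphs $H$ with $v(H)\le n$ and $H\not\succ F$; $\mathrm{gex}(F,n)$ is the maximum of $e(G)$ over simple graphs $G$ with at most $n$ vertices and $G\not\succ F$. Ackermann function: $F_1(n)=2n$, $F_{i+1}(n)=F_i(F_i(\cdots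 F_i(1)\cdots))$ ($n$ iterations), $A(n)=F_n(n)$, $\alpha(n)=\min\{m:A(m)\ge n\}$. $f\ll g$ means $|f(n)|<c|g(n)|$ for a constant $c>0$ and all large $n$. *)

(* Defs.v *)
From HB Require Import structures.
From mathcomp Require Import all_boot all_order all_algebra.
From mathcomp Require Import finmap.
From mathcomp Require Import boolp classical_sets filter reals.

Set Implicit Arguments.
Unset Strict Implicit.
Unset Printing Implicit Defensive.

Import Order.TTheory GRing.Theory Num.Theory.

Local Open Scope fset_scope.
Local Open Scope nat_scope.

(* Only the order of the vertices is used, so it is immaterial that [nat]
   starts at 0. The index set of [H] is ['I_(size H)]; nonemptiness of the
   edges is part of [simple_hypergraph]. *)
Definition hypergraph := seq {fset nat}.

(* There are no isolated vertices: the vertices are those covered by edges. *)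
Definition vset (H : hypergraph) : {fset nat} :=
  \big[fsetU/fset0]_(E <- H) E.

Definition nvert (H : hypergraph) : nat := #|` vset H|.
Definition nedge (H : hypergraph) : nat := size H.
Definition nincid (H : hypergraph) : nat := \sum_(E <- H) #|` E|.

Definition simple_hypergraph (H : hypergraph) : bool :=
  all (fun E => E != fset0) H && uniq H.

Definition simple_graph (G : hypergraph) : bool :=
  simple_hypergraph G && all (fun E => #|` E| == 2) G.

Definition contains (H H' : hypergraph) : Prop :=
  exists (phi : vset H' -> vset H) (f : 'I_(size H') -> 'I_(size H)),
    [/\ forall x y : vset H', val x < val y -> val (phi x) < val (phi y),
        injective f
      & forall (i : 'I_(size H')) (v : vset H'),
          val v \in nth fset0 H' i -> val (phi v) \in nth fset0 H (f i)].

Definition degree (H : hypergraph) (v : nat) : nat :=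
  count (fun E : {fset nat} => v \in E) H.

Definition adjacent (H : hypergraph) : rel (vset H) :=
  fun x y => has (fun E : {fset nat} => (val x \in E) && (val y \in E)) H.

Definition ncomponents (H : hypergraph) : nat :=
  n_comp (@adjacent H) {: vset H}.

Definition star_forest (F : hypergraph) : Prop :=
  simple_graph F /\
  exists A B : {fset nat},
    [/\ vset F = A `|` B,
        forall a b, a \in A -> b \in B -> a < b,
        forall b, b \in B -> degree F b = 1
      & forall E, E \in F ->
          exists a b, [/\ a \in A, b \in B & E = [fset a; b]]].

Definition is_maximum (w : hypergraph -> nat) (C : hypergraph -> Prop)
    (m : nat) : Prop :=
  (exists2 H, C H & w H = m) /\ (forall H, C H -> w H <= m).

(* 0 by convention when there is no maximum; see [ex_eP], [ex_iP], [gexP]. *)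
Definition maximum (w : hypergraph -> nat) (C : hypergraph -> Prop) : nat :=
  xget 0 (is_maximum w C).

Definition avoiding (F : hypergraph) (n : nat) (H : hypergraph) : Prop :=
  nvert H <= n /\ ~ contains H F.

Definition ex_e (F : hypergraph) (n : nat) : nat :=
  maximum nedge (fun H => simple_hypergraph H /\ avoiding F n H).
Definition ex_i (F : hypergraph) (n : nat) : nat :=
  maximum nincid (fun H => simple_hypergraph H /\ avoiding F n H).
Definition gex (F : hypergraph) (n : nat) : nat :=
  maximum nedge (fun G => simple_graph G /\ avoiding F n G).

(* [fast_growing i] is the function F_(i+1) of the hierarchy F_1, F_2, ... *)
Fixpoint fast_growing (i n : nat) : nat :=
  if i is j.+1 then iter n (fast_growing j) 1 else 2 * n.

(* A(m) = F_m(m), meaningful for m >= 1. *)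
Definition ackermann (m : nat) : nat := fast_growing m.-1 m.

Lemma fast_growing_gt i n : 0 < n -> n < fast_growing i n.
Proof.
elim: i n => [|i IH] n n0 /=; first by rewrite mul2n -addnn -[X in X < _]addn0 ltn_add2l.
have H k : k < iter k (fast_growing i) 1.
  elim: k => [//|k IHk] /=.
  by apply: leq_ltn_trans (IHk) (IH _ _); apply: leq_ltn_trans IHk.
exact: H.
Qed.

Lemma alpha_ex n : exists m, (0 < m) && (n <= ackermann m).
Proof. by exists n.+1; apply: ltnW; apply: ltnW; apply: fast_growing_gt. Qed.

Definition alpha (n : nat) : nat := ex_minn (alpha_ex n).

Definition beta (k l n : nat) : nat :=
  k * 2 ^ (k * l - 3) *
  (10 * k) ^ (2 * alpha n ^ (k * l - 4) + 8 * alpha n ^ (k * l - 5)).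

Definition vinogradov (R : realType) (f g : nat -> R) : Prop :=
  (exists2 c : R, 0 < c & \forall n \near (\oo)%classic, `|f n| < c * `|g n|)%R.

Lemma sub_vset (H : hypergraph) (E : {fset nat}) : E \in H -> E `<=` vset H.
Proof.
by move=> EH; rewrite /vset; apply/fsubsetP => x xE; apply/bigfcupP; exists E; rewrite ?EH.
Qed.

Lemma nedge_le (H : hypergraph) n :
  simple_hypergraph H -> nvert H <= n -> nedge H <= 2 ^ n.
Proof.
move=> /andP[_ uH] Hn; apply: leq_trans (leq_pexp2l _ Hn) => //.
rewrite -card_fpowerset; apply: uniq_leq_size uH _ => E EH.
by rewrite fpowersetE sub_vset.
Qed.

Lemma nincid_le (H : hypergraph) n :
  simple_hypergraph H -> nvert H <= n -> nincid H <= 2 ^ n * n.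
Proof.
move=> sH Hn; apply: leq_trans (_ : nedge H * n <= _); last first.
  by rewrite leq_mul2r nedge_le ?orbT.
rewrite /nincid /nedge -sum1_size big_distrl /= big_seq [leqRHS]big_seq.
apply: leq_sum => E EH; rewrite mul1n.
exact: leq_trans (fsubset_leq_card (sub_vset EH)) Hn.
Qed.

Lemma maximumP w C b : (exists H, C H) -> (forall H, C H -> w H <= b) ->
  is_maximum w C (maximum w C).
Proof.
move=> [H0 CH0] bnd; rewrite /maximum; apply: xgetPex.
have Pex : exists k, `[< exists2 H, C H & w H = k >].
  by exists (w H0); apply/asboolP; exists H0.
have Pub k : `[< exists2 H, C H & w H = k >] -> k <= b.
  by move=> /asboolP[H CH <-]; apply: bnd.
case: (ex_maxnP Pex Pub) => m /asboolP Pm mmax; exists m; split=> // H CH.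
by apply: mmax; apply/asboolP; exists H.
Qed.

Lemma avoiding_nil F n : F != [::] -> avoiding F n [::].
Proof.
case: F => // E F _; split; first by rewrite /nvert /vset big_nil cardfs0.
by move=> [phi [f _]]; case: (f ord0).
Qed.

Lemma ex_eP F n : F != [::] ->
  is_maximum nedge (fun H => simple_hypergraph H /\ avoiding F n H) (ex_e F n).
Proof.
move=> F0; apply: (@maximumP _ _ (2 ^ n)).
  by exists [::]; split=> //; exact: avoiding_nil.
by move=> H [sH [Hn _]]; exact: nedge_le.
Qed.

Lemma ex_iP F n : F != [::] ->
  is_maximum nincid (fun H => simple_hypergraph H /\ avoiding F n H) (ex_i F n).
Proof.
move=> F0; apply: (@maximumP _ _ (2 ^ n * n)).
  by exists [::]; split=> //; exact: avoiding_nil.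
by move=> H [sH [Hn _]]; exact: nincid_le.
Qed.

Lemma gexP F n : F != [::] ->
  is_maximum nedge (fun G => simple_graph G /\ avoiding F n G) (gex F n).
Proof.
move=> F0; apply: (@maximumP _ _ (2 ^ n)).
  by exists [::]; split=> //; exact: avoiding_nil.
by move=> G [/andP[sG _] [Gn _]]; exact: nedge_le.
Qed.

(* Main.v *)
(* A graph avoiding a star forest with centers A and leaves B has an adjacency
   matrix without "formations": r = |A| rows and s successive groups of columns
   such that each of the rows has an entry in each group.  The number of entries
   of a formation-free matrix is bounded by cutting the columns into blocks.
   Rows living in one block are handled recursively; a row meeting several
   blocks has, in each block that it meets, a later or an earlier entry
   elsewhere, so that these rows contain no (s-1)-formation inside the block,
   while the number of (row, block) incidences is bounded by the contracted,
   still formation-free, matrix.  Iterating along the Ackermann hierarchy gives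
   O(n (4r)^((s+1) alpha(n)^s)) entries.

   For a hypergraph H, join x < y when they lie at distance less than p inside
   some edge of H.  A center then sees each edge of H at most p-1 times, so t
   neighbours per leaf suffice to choose distinct edges greedily: this graph has
   no (tq+1)-formation, it is degenerate and has few cliques.  An edge E of H has
   at least |E|/p subsets of min(p,|E|) nearby vertices, which are cliques, and a
   clique arises from at most q edges, as q edges sharing p vertices contain F. *)
Require Import Defs.
From mathcomp Require Import all_boot all_order all_algebra.
From mathcomp Require Import finmap.
From mathcomp Require Import boolp classical_sets filter reals.
From mathcomp Require Import zify.

Set Implicit Arguments.
Unset Strict Implicit.
Unset Printing Implicit Defensive.

Import Order.TTheory GRing.Theory Num.Theory.

(** * Formation-free matrices *)

Section Formations.
Variables (T : finType) (r : nat).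
Implicit Types (M : T -> nat -> bool) (P Q : {set T}).

(* [sel k x] is a column of the [k]-th group in which row [x] has an entry. *)
Definition formation s M P :=
  exists (S : {set T}) (sel : nat -> T -> nat),
    [/\ S \subset P, #|S| = r,
        forall k x, k < s -> x \in S -> M x (sel k x)
      & forall k l x y, k < l -> l < s -> x \in S -> y \in S ->
          sel k x < sel l y].

Definition weight M P m := \sum_(x in P) \sum_(c < m) M x c.

(** [K] is the price of a row, [D] that of all columns together. Being uniform in [M] and [P], the
    bound also applies to blocks and to contracted matrices. *)
Definition bounded s m K D :=
  forall M P, ~ formation s M P -> weight M P m <= K * #|P| + D.

Lemma bounded_weaken s m K D m' K' D' :
  bounded s m K D -> m' <= m -> K <= K' -> D <= D' -> bounded s m' K' D'.
Proof.
move=> bd mm KK DD M P fr.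
apply: (@leq_trans (weight M P m)).
  apply: leq_sum => x _.
  rewrite -!(big_mkord predT (fun c => M x c : nat)).
  by rewrite (big_cat_nat (leq0n m') mm) leq_addr.
by apply: leq_trans (bd _ _ fr) _; rewrite leq_add // leq_mul2r KK orbT.
Qed.

Lemma bounded_trivial s m : bounded s m m 0.
Proof.
move=> M P _; rewrite addn0 mulnC -sum_nat_const; apply: leq_sum => x _.
rewrite -[leqRHS]card_ord -sum1_card; apply: leq_sum => c _; exact: leq_b1.
Qed.

(** With no groups, any [r] rows of [P] already make a formation; so [P] is small and the weight can
    be charged to the columns alone. *)
Lemma bounded0 m : bounded 0 m 0 (r * m).
Proof.
move=> M P fr; rewrite mul0n add0n.
have Pr : #|P| <= r.
  rewrite leqNgt; apply/negP => rP; apply: fr.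
  have /set0Pn[S] : [set S : {set T} | S \subset P & #|S| == r] != finset.set0.
    by rewrite -card_gt0 cards_draws bin_gt0 ltnW.
  by rewrite inE => /andP[SP /eqP cS]; exists S, (fun _ _ => 0).
apply: leq_trans (@bounded_trivial 0 m M P fr) _.
by rewrite addn0 mulnC leq_mul2r Pr orbT.
Qed.

(** Columns are renumbered from 0 and cut at [w], so that a formation of the block cannot leave
    it. *)
Definition block M w b x c := (c < w) && M x (b * w + c).
Definition contract M w x b := has (fun c => M x (b * w + c)) (iota 0 w).

Lemma formation_sub s M P Q : P \subset Q -> formation s M P -> formation s M Q.
Proof.
by move=> PQ [S [sel [SP cS h1 h2]]]; exists S, sel; split=> //; apply: fintype.subset_trans PQ.
Qed.

Lemma formation_block s M w b P : formation s (block M w b) P -> formation s M P.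
Proof.
move=> [S [sel [SP cS h1 h2]]]; exists S, (fun k x => b * w + sel k x).
split=> // [k x ks xS|k l x y kl ls xS yS].
  by have /andP[] := h1 k x ks xS.
by rewrite ltn_add2l h2.
Qed.

(** A selected block is replaced by the first entry of the row in it; columns of distinct blocks are
    ordered as the blocks are. *)
Lemma formation_contract s M w P : formation s (contract M w) P -> formation s M P.
Proof.
move=> [S [sel [SP cS h1 h2]]].
pose f x b := find (fun c => M x (b * w + c)) (iota 0 w).
have fP x b : contract M w x b -> f x b < w /\ M x (b * w + f x b).
  move=> h; have h3 : f x b < w by move: (h); rewrite /contract has_find size_iota.
  by split=> //; have := nth_find 0 h; rewrite nth_iota.
exists S, (fun k x => sel k x * w + f x (sel k x)); split=> //.
  by move=> k x ks xS; case: (fP _ _ (h1 k x ks xS)).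
move=> k l x y kl ls xS yS.
have [fw _] := fP _ _ (h1 k x (ltn_trans kl ls) xS).
have := h2 k l x y kl ls xS yS => hl.
apply: (@leq_trans ((sel k x).+1 * w)); first by rewrite mulSn addnC ltn_add2r.
by apply: (leq_trans _ (leq_addr _ _)); rewrite leq_mul2r hl orbT.
Qed.

(** The later entries become a last group. Columns within one group need not be ordered, so each row
    may bring its own entry. *)
Lemma formation_block_later s M w b P (Q : {set T}) : Q \subset P ->
  (forall x, x \in Q -> exists2 c, b.+1 * w <= c & M x c) ->
  formation s (block M w b) Q -> formation s.+1 M P.
Proof.
move=> QP later [S [sel [SQ cS h1 h2]]].
have /boolp.choice[g gP] : forall x, exists c, x \in S -> b.+1 * w <= c /\ M x c.
  move=> x; case: (boolP (x \in S)) => [xS|]; last by exists 0.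
  by have [c ? ?] := later x (fintype.subsetP SQ x xS); exists c.
exists S, (fun k x => if k < s then b * w + sel k x else g x); split=> //.
- exact: fintype.subset_trans QP.
- move=> k x ks xS; case: ifP => [k1|_]; last by case: (gP x xS).
  by have /andP[] := h1 k x k1 xS.
move=> k l x y kl ls xS yS.
have ks : k < s by apply: leq_trans kl _.
rewrite ks; case: ifP => [l1|_]; first by rewrite ltn_add2l h2.
apply: (@leq_trans (b.+1 * w)); last by case: (gP y yS).
by have /andP[kw _] := h1 k x ks xS; rewrite mulSn addnC ltn_add2r.
Qed.

(** Mirror image: the earlier entries become group 0 and the groups of the block are shifted by
    one. *)
Lemma formation_block_earlier s M w b P (Q : {set T}) : Q \subset P ->
  (forall x, x \in Q -> exists2 c, c < b * w & M x c) ->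
  formation s (block M w b) Q -> formation s.+1 M P.
Proof.
move=> QP later [S [sel [SQ cS h1 h2]]].
have /boolp.choice[g gP] : forall x, exists c, x \in S -> c < b * w /\ M x c.
  move=> x; case: (boolP (x \in S)) => [xS|]; last by exists 0.
  by have [c ? ?] := later x (fintype.subsetP SQ x xS); exists c.
exists S, (fun k x => if k is j.+1 then b * w + sel j x else g x); split=> //.
- exact: fintype.subset_trans QP.
- move=> [|k] x ks xS; first by case: (gP x xS).
  by have /andP[] := h1 k x ks xS.
move=> [|k] [|l] x y // kl ls xS yS; last by rewrite ltn_add2l h2.
by apply: leq_trans (leq_addr _ _); case: (gP x xS).
Qed.

Lemma weight_block M P w N :
  weight M P (N * w) = \sum_(b < N) weight (block M w b) P w.
Proof.
rewrite /weight [RHS]exchange_big /=; apply: eq_bigr => x _.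
rewrite -(big_mkord predT (fun c => M x c : nat)) big_nat_mul big_mkord.
apply: eq_bigr => b _; rewrite -{1}[b * w]add0n big_addn mulSn addnK big_mkord.
by apply: eq_bigr => c _; rewrite /block ltn_ord addnC.
Qed.

Lemma weight_setE M P Q m :
  Q \subset P -> weight M Q m = \sum_(x in P) (x \in Q) * \sum_(c < m) M x c.
Proof.
move=> QP; rewrite /weight [RHS](finset.big_setID Q) /= (finset.setIidPr QP) [X in _ = _ + X]big1 ?addn0.
  by apply: eq_bigr => x ->; rewrite mul1n.
by move=> x; rewrite inE => /andP[/negbTE->].
Qed.

Lemma card_sumE (P : {set T}) : #|P| = \sum_x (x \in P).
Proof. by rewrite -sum1_card big_mkcond. Qed.

(* The [N] blocks have width [w]: [L b] are the rows living in block [b] only,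
   [G1 b] and [G2 b] the other rows of block [b] with, resp. without, an entry in
   a later block. *)
Lemma bounded_step s w N B K D K' D' :
  bounded s w B (B * w) -> bounded s.+1 w K D -> bounded s.+1 N K' D' ->
  B * K' <= K ->
  bounded s.+1 (N * w) K (N * D + B * D' + 2 * B * (N * w)).
Proof.
move=> bs bw bN KK M P fr.
pose C := contract M w.
pose L (b : 'I_N) := [set x in P | C x b && [forall b' : 'I_N, C x b' ==> (b' == b)]].
pose G1 (b : 'I_N) := [set x in P | C x b && [exists b' : 'I_N, C x b' && (b < b')]].
pose G2 (b : 'I_N) := [set x in P |
  [&& C x b, x \notin G1 b & [exists b' : 'I_N, C x b' && (b' < b)]]].
pose G := [set x in P | [exists b : 'I_N, (x \in G1 b) || (x \in G2 b)]].
have sP (p : pred T) : [set x in P | p x] \subset P.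
  by apply/fintype.subsetP => x; rewrite inE => /andP[].
have CP x b : C x b -> exists2 c, b * w <= c < b.+1 * w & M x c.
  case/hasP => c; rewrite mem_iota add0n => /= cw Mc; exists (b * w + c) => //.
  by rewrite leq_addr mulSn addnC ltn_add2r.
(* A row with an entry in block [b] lies in [L b], [G1 b] or [G2 b]: any other block that it meets
   is later or earlier. *)
have w1 : weight M P (N * w) <= \sum_(b < N) (weight (block M w b) (L b) w +
    weight (block M w b) (G1 b) w + weight (block M w b) (G2 b) w).
  rewrite weight_block; apply: leq_sum => b _.
  rewrite (weight_setE _ _ (sP _ : L b \subset P)) (weight_setE _ _ (sP _ : G1 b \subset P)).
  rewrite (weight_setE _ _ (sP _ : G2 b \subset P)) -!big_split /=; apply: leq_sum => x xP.

  rewrite -!mulnDl; have [->//|] := posnP (\sum_(c < w) block M w b x c).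
  move=> pos; apply: leq_pmull.
  have Cb : C x b.
    apply/hasP; move: pos; rewrite lt0n sum_nat_eq0 => /forallPn[c].
    rewrite /= eqb0 negbK => /andP[cw Mc]; exists (c : nat) => //.
    by rewrite mem_iota add0n leq0n.
  rewrite !inE xP Cb /=.
  case: (boolP [forall _, _]) => // /forallPn[b']; rewrite negb_imply => /andP[Cb' nb].
  case: (boolP [exists _, _]) => //= /existsPn nG1.
  have lt : b' < b.
    rewrite ltn_neqAle nb leqNgt; apply: contra (nG1 b') => ->.
    by rewrite Cb'.
  by rewrite (_ : [exists _, _]) //; apply/existsP; exists b'; rewrite Cb'.
have w2 (b : 'I_N) : weight (block M w b) (L b) w <= K * #|L b| + D.
  by apply: bw => /formation_block h; apply: fr; exact: formation_sub (sP _) h.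
have w3 (b : 'I_N) : weight (block M w b) (G1 b) w <= B * #|G1 b| + B * w.
  apply: bs => h; apply: fr; apply: (formation_block_later (sP _ : G1 b \subset P) _ h) => x.
  rewrite !inE => /and3P[_ _ /existsP[b' /andP[/CP[c /andP[c1 _] Mc] bb']]].
  by exists c => //; apply: leq_trans c1; rewrite leq_mul2r bb' orbT.
have w4 (b : 'I_N) : weight (block M w b) (G2 b) w <= B * #|G2 b| + B * w.
  apply: bs => h; apply: fr; apply: (formation_block_earlier (sP _ : G2 b \subset P) _ h) => x.
  rewrite inE => /and4P[_ _ _ /existsP[b' /andP[/CP[c /andP[_ c1] Mc] bb']]].
  by exists c => //; apply: leq_trans c1 _; rewrite leq_mul2r bb' orbT.
(* [G1 b] and [G2 b] are disjoint, and each of their rows is an entry in column [b] of the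
   contracted matrix [C]. *)
have w5 : \sum_(b < N) (#|G1 b| + #|G2 b|) <= K' * #|G| + D'.
  apply: (@leq_trans (weight C G N)); last first.
    by apply: bN => /formation_contract h; apply: fr; exact: formation_sub (sP _) h.
  rewrite /weight exchange_big /=; apply: leq_sum => b _.
  rewrite !card_sumE -big_split [leqRHS]big_mkcond; apply: leq_sum => x _ /=.
  case: (boolP (x \in G1 b)) => h1.
    have -> : x \in G by rewrite inE (fintype.subsetP (sP _) _ h1); apply/existsP; exists b; rewrite h1.
    have /negbTE-> : x \notin G2 b by rewrite inE h1 !andbF.
    by move: h1; rewrite inE => /and3P[_ -> _].
  case: (boolP (x \in G2 b)) => // h2.
  have -> : x \in G.
    by rewrite inE (fintype.subsetP (sP _) _ h2); apply/existsP; exists b; rewrite h2 orbT.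
  by move: h2; rewrite inE => /and4P[_ -> _].
have w6 : \sum_(b < N) #|L b| + #|G| <= #|P|.
  under eq_bigr do rewrite card_sumE.
  rewrite exchange_big /= !card_sumE -big_split /=; apply: leq_sum => x _.
  case: (boolP (x \in G)) => xG.
    move: (xG); rewrite inE => /andP[-> /existsP[b hb]]; rewrite big1 // => b' _.
    case: (boolP (x \in L b')) => //; rewrite inE => /and3P[_ Cb' /forallP all'].
    case/orP: hb; rewrite !inE.
      case/and3P => _ Cb /existsP[b2 /andP[Cb2 bb2]].
      by move: bb2; rewrite (eqP (implyP (all' b) Cb)) (eqP (implyP (all' b2) Cb2)) ltnn.
    case/and4P => _ Cb _ /existsP[b2 /andP[Cb2 bb2]].
    by move: bb2; rewrite (eqP (implyP (all' b) Cb)) (eqP (implyP (all' b2) Cb2)) ltnn.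
  rewrite addn0; case: (boolP [exists b, x \in L b]) => [/existsP[b xb]|/existsPn no].
    rewrite (bigD1 b) //= xb big1 ?addn0 => [|b' nb].
      by rewrite (fintype.subsetP (sP _) _ xb).
    case: (boolP (x \in L b')) => //; rewrite inE => /and3P[_ _ /forallP all'].
    by move: xb; rewrite inE => /and3P[_ Cb _]; rewrite eq_sym (implyP (all' b) Cb) in nb.
  by rewrite big1 // => b _; rewrite (negbTE (no b)).
apply: leq_trans w1 _.
apply: (@leq_trans (\sum_(b < N) (K * #|L b| + D + B * (#|G1 b| + #|G2 b|) + 2 * B * w))).
  apply: leq_sum => b _; have := w2 b; have := w3 b; have := w4 b; lia.
rewrite !big_split /= -!big_distrr /= !sum_nat_const card_ord.
(* [B * K' <= K] lets the rows of [G] be paid at the price [K], like the rows of the sets [L b]. *)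
have : B * \sum_(b < N) (#|G1 b| + #|G2 b|) <= K * #|G| + B * D'.
  apply: leq_trans (leq_mul (leqnn B) w5) _.
  by rewrite mulnDr mulnA leq_add2r leq_mul2r KK orbT.
have : K * (\sum_(b < N) #|L b| + #|G|) <= K * #|P| by rewrite leq_mul2l w6 orbT.
rewrite mulnDr.
move: (\sum_(b < N) #|L b|) (\sum_(b < N) (_ + _)) => X Y; clear; nia.
Qed.

End Formations.

(** Powers of two divide one another, so widths given by these functions cut the columns into equal
    blocks exactly. *)
Lemma fast_growing_pow2 i n : exists k, fast_growing i.+1 n = 2 ^ k.
Proof.
elim: i n => [|i IH] n.
  by exists n; elim: n => //= n ->; rewrite expnS.
case: n => [|n]; first by exists 0.
exact: IH.
Qed.

Lemma fast_growing1 n : fast_growing 1 n = 2 ^ n.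
Proof. by elim: n => //= n ->; rewrite expnS. Qed.

(** * Column costs along the Ackermann hierarchy *)

Section Levels.
Variables (T : finType) (r s B c : nat).
Hypothesis B_gt0 : 0 < B.
(** The bound for one group less, with one constant [B] for all widths up to [c]; [c] stands for the
    Ackermann value limiting the number of columns. *)
Hypothesis bounded_prev : forall e, 2 ^ e <= c -> bounded T r s (2 ^ e) B (B * 2 ^ e).

(** Repeated halving: contracting two halves leaves two columns, where the trivial bound applies,
    and each of the [e] halvings costs [2 * B] per column. *)
Lemma bounded_level0 e : 2 ^ e <= c ->
  bounded T r s.+1 (2 ^ e) (2 * B) (2 * B * (e * 2 ^ e)).
Proof.
elim: e => [_|e IH ec].
  apply: bounded_weaken (@bounded_trivial T r s.+1 1) _ _ _ => //; lia.
have ec' : 2 ^ e <= c by apply: leq_trans ec; rewrite leq_exp2l.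
have h := bounded_step (bounded_prev ec') (IH ec') (@bounded_trivial T r s.+1 2).
have {}h := h (eq_leq (mulnC _ _)).
apply: bounded_weaken h _ _ _ => //; rewrite ?expnS //; nia.
Qed.

(** The factor [e] of the halving argument is replaced by [j], an inverse of ever faster functions;
    each new level costs a factor [2 * B]. *)
Lemma bounded_level i j e : 2 ^ e <= c -> 2 ^ e <= fast_growing i.+1 j ->
  bounded T r s.+1 (2 ^ e) ((2 * B) ^ i.+1) ((2 * B) ^ i.+1 * (j * 2 ^ e)).
Proof.
elim: i j e => [|i IH] j e ec.
  rewrite fast_growing1 leq_exp2l // => ej.
  apply: bounded_weaken (bounded_level0 ec) _ _ _; rewrite ?expn1 //.
  by rewrite !leq_mul.
elim: j e ec => [|j IHj] e ec.
  rewrite [fast_growing _ _]/= -[X in _ <= X]/(2 ^ 0) leq_exp2l // leqn0 => /eqP->.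
  apply: bounded_weaken (@bounded_trivial T r s.+1 1) _ _ _ => //.
  by rewrite expn_gt0 muln_gt0 B_gt0.
(* Blocks of width [2 ^ f], the value at [j], fall under [IHj]. The contracted matrix falls under
   the lower level with argument [2 ^ f]: up to a constant its column cost is [2 ^ f * 2 ^ (e - f)],
   linear in the number of columns. *)
have [f Ef] := fast_growing_pow2 i.+1 j.
have -> : fast_growing i.+2 j.+1 = fast_growing i.+1 (2 ^ f) by rewrite -Ef.
move=> eF; have [ef|fe] := leqP e f.
  apply: bounded_weaken (IHj e ec _) _ _ _ => //; first by rewrite Ef leq_exp2l.
  by rewrite leq_mul2l leq_mul2r leqnSn !orbT.
have fc : 2 ^ f <= c by apply: leq_trans ec; rewrite leq_exp2l // ltnW.
have le1 : 2 ^ (e - f) <= 2 ^ e by rewrite leq_exp2l // leq_subr.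
have h := bounded_step (bounded_prev fc) (IHj f fc (eq_leq (esym Ef)))
  (IH _ _ (leq_trans le1 ec) (leq_trans le1 eF)).
have {}h : bounded _ _ _ _ _ _ := h _.
have Em : 2 ^ (e - f) * 2 ^ f = 2 ^ e by rewrite -expnD subnK // ltnW.
apply: bounded_weaken (h _) _ _ _ => //; rewrite ?Em //.
  by rewrite (expnS _ i.+1) -mulnA leq_pmull // leq_mul2l leq_pmull ?orbT.
(* With [X = (2 * B) ^ i.+1 >= 2], the new cost [B * X + 2 * B] per column fits in [2 * B * X], the
   increment from [j] to [j.+1]. *)
have L2 : 2 <= (2 * B) ^ i.+1 by rewrite expnS; have : 0 < (2*B)^i; [rewrite expn_gt0 muln_gt0 B_gt0|nia].
rewrite (expnS _ i.+1).
have E1 : 2 ^ (e - f) * (2 * B * (2 * B) ^ i.+1 * (j * 2 ^ f)) =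
   2 * B * (2 * B) ^ i.+1 * (j * 2 ^ e) by rewrite -Em; nia.
have E2 : (2 * B) ^ i.+1 * (2 ^ f * 2 ^ (e - f)) = (2 * B) ^ i.+1 * 2 ^ e.
  by rewrite (mulnC (2 ^ f)) Em.
rewrite E1 E2; move: ((2 * B) ^ i.+1) (2 ^ e) L2 => X Y L2; nia.
Qed.

End Levels.

(** Each new group raises the constant roughly to the power [a], through [bounded_level] with
    [i = a - 2] and [j = a]; the factor [r] comes from [bounded0]. *)
Lemma bounded_ackermann (T : finType) r a : 0 < r -> 1 < a -> forall s e, 2 ^ e <= ackermann a ->
  bounded T r s (2 ^ e) ((4 * r) ^ (s.+1 * a ^ s)) ((4 * r) ^ (s.+1 * a ^ s) * 2 ^ e).
Proof.
move=> r0 a1; elim=> [|s IH] e ec.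
  apply: bounded_weaken (@bounded0 T r _) (leqnn _) _ _ => //.
  by rewrite leq_mul2r mul1n expn1 leq_pmull ?orbT.
set B := (4 * r) ^ (s.+1 * a ^ s) in IH.
have B0 : 0 < B by rewrite expn_gt0 muln_gt0 r0.
have Ea : ackermann a = fast_growing (a - 2).+1 a by rewrite /ackermann; congr fast_growing; lia.
have h := bounded_level B0 IH ec (leq_trans ec (eq_leq Ea)).
have aa : a <= 2 ^ a by rewrite ltnW // ltn_expl.
(* By [a <= 2 ^ a] the left side is at most [(4 * B) ^ a]; in base [4 * r] the exponent becomes
   [(s.+1 * a ^ s + 1) * a]. *)
have key : (2 * B) ^ (a - 2).+1 * a <= (4 * r) ^ (s.+2 * a ^ s.+1).
  apply: (@leq_trans ((4 * B) ^ a)).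
    rewrite (_ : 4 * B = (2 * B) * 2) ?(expnMn (2 * B) 2); last lia.
    apply: leq_mul => //. apply: leq_pexp2l; first by rewrite muln_gt0.
    lia.
  apply: (@leq_trans (((4 * r) * B) ^ a)).
    by rewrite leq_exp2r ?(ltnW a1) // leq_mul2r leq_pmulr // orbT.
  rewrite -expnS -expnM leq_pexp2l ?muln_gt0 ?r0 //.
  have : 0 < a ^ s by rewrite expn_gt0 (ltnW a1).
  rewrite expnS; move: (a ^ s) => Y Y0; nia.
apply: bounded_weaken h (leqnn _) _ _ => //.
  by apply: leq_trans key; rewrite leq_pmulr // ltnW.
by rewrite mulnA leq_mul2r key orbT.
Qed.

(** * Sparse graphs on the integers *)

Definition vertex_formation (e : rel nat) r s :=
  exists (S : seq nat) (sel : nat -> nat -> nat),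
    [/\ uniq S, size S = r,
        forall k x, k < s -> x \in S -> e x (sel k x)
      & forall k l x y, k < l -> l < s -> x \in S -> y \in S ->
          sel k x < sel l y].

(* The factor 3 accounts for the rows and for the columns, whose number is
   rounded up to a power of two. *)
Definition density r s a := 3 * (4 * r) ^ (s.+1 * a ^ s).

Lemma sparse_sorted (e : rel nat) r s a (ws : seq nat) :
  0 < r -> 1 < a -> sorted ltn ws -> size ws <= ackermann a ->
  ~ vertex_formation e r s ->
  \sum_(x <- ws) \sum_(y <- ws) e x y <= density r s a * size ws.
Proof.
move=> r0 a1 sw wa fr; case: (posnP (size ws)) => [/size0nil->|k0].
  by rewrite big_nil.
set k := size ws in k0 *.
pose M (i : 'I_k) c := (c < k) && e (nth 0 ws i) (nth 0 ws c).
have uw : uniq ws by apply: sorted_uniq sw; [exact: ltn_trans | exact: ltnn].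
have frM : ~ formation r s M [set: 'I_k]%SET.
  move=> [S [sel [_ cS h1 h2]]]; apply: fr.
  pose v (i : 'I_k) := nth 0 ws i.
  have vinj : injective v.
    by move=> i j /eqP; rewrite nth_uniq // => /eqP /val_inj.
  have /boolp.choice[g gP] : forall x, exists f, x \in map v (enum S) ->
      exists2 i, i \in S & x = v i /\ forall k, f k = nth 0 ws (sel k i).
    move=> x; case: (boolP (x \in map v (enum S))); last by exists id.
    case/mapP => i; rewrite mem_enum => iS ->.
    by exists (fun k => nth 0 ws (sel k i)) => _; exists i.
  exists (map v (enum S)), (fun k x => g x k); split.
  - by rewrite map_inj_uniq ?enum_uniq.
  - by rewrite size_map -cardE.
  - move=> l x ls /gP[i iS [-> ->]].
    by have /andP[] := h1 l i ls iS.
  move=> l1 l2 x y l12 l2s /gP[i iS [_ ->]] /gP[j jS [_ ->]].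
  have /andP[c1 _] := h1 l1 i (ltn_trans l12 l2s) iS.
  have /andP[c2 _] := h1 l2 j l2s jS.
  by apply: (sorted_ltn_nth ltn_trans) => //; exact: h2.
have -> : \sum_(x <- ws) \sum_(y <- ws) e x y = weight M [set: 'I_k]%SET k.
  rewrite (big_nth 0) big_mkord; apply: eq_big => [i|i _]; first by rewrite inE.
  by rewrite (big_nth 0) big_mkord; apply: eq_bigr => c _; rewrite /M ltn_ord.
(* Since the Ackermann value is itself a power of two, rounding [k] up to a power of two does not
   exceed it. *)
have [f Ef] : exists f, ackermann a = 2 ^ f.
  by case: a a1 {wa} => [|[|a]] // _; apply: fast_growing_pow2.
pose d := up_log 2 k.
have kd : k <= 2 ^ d by apply: up_logP.
have dk : 2 ^ d <= 2 * k.
  have [k1|k1] := leqP k 1; first by rewrite /d (_ : k = 1) ?up_log1 //; lia.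
  have /andP[] := up_log_bounds (isT : 1 < 2) k1; rewrite -/d => h _.
  have d0 : 0 < d by rewrite up_log_gt0 k1.
  by rewrite -(prednK d0) expnS leq_mul2l ltnW.
have da : 2 ^ d <= ackermann a by rewrite Ef leq_exp2l // up_log_min // -Ef.
have bd := bounded_weaken (@bounded_ackermann 'I_k r a r0 a1 s d da) kd (leqnn _) (leqnn _).
apply: leq_trans (bd _ _ frM) _; rewrite cardsT card_ord /density.
by move: ((4 * r) ^ _) => X; nia.
Qed.

Lemma sparse (e : rel nat) r s a (W : {fset nat}) :
  0 < r -> 1 < a -> #|` W| <= ackermann a -> ~ vertex_formation e r s ->
  \sum_(x <- W) \sum_(y <- W) e x y <= density r s a * #|` W|.
Proof.
move=> r0 a1 Wa fr; have pW : perm_eq W (sort leq W) by rewrite perm_sym perm_sort.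
rewrite (perm_big _ pW) (eq_bigr _ (fun x _ => perm_big _ pW)) /=.
have := @sparse_sorted e r s a (sort leq W) r0 a1; rewrite size_sort; apply=> //.
by rewrite ltn_sorted_uniq_leq sort_uniq fset_uniq sort_sorted //; exact: leq_total.
Qed.

(** * Star forests *)

Lemma mem_vset (H : hypergraph) v :
  reflect (exists2 E, E \in H & v \in E) (v \in vset H).
Proof.
apply: (iffP idP) => [|[E EH vE]].
  by case/bigfcupP => E; rewrite andbT; exists E.
by apply/bigfcupP; exists E; rewrite ?EH.
Qed.

(** Embeddings can be given by total functions on numbers and on edges; the index map of [contains]
    is recovered from positions in the lists. *)
Lemma containsI (H F : hypergraph) (phi : nat -> nat) (g : {fset nat} -> {fset nat}) :
  uniq F ->
  {in vset F &, forall x y, x < y -> phi x < phi y} ->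
  {in F, forall E, g E \in H} ->
  (forall E v, E \in F -> v \in E -> phi v \in g E) ->
  {in F &, injective g} -> contains H F.
Proof.
move=> uF mono gH phig ginj.
have phiP (v : vset F) : phi (val v) \in vset H.
  have /mem_vset[E EF vE] := valP v.
  by apply/mem_vset; exists (g E); [exact: gH | exact: phig].
have nF (i : 'I_(size F)) : nth fset0 F i \in F by rewrite mem_nth.
have gP (i : 'I_(size F)) : index (g (nth fset0 F i)) H < size H.
  by rewrite index_mem gH.
exists (fun v => [` phiP v]%fset), (fun i => Ordinal (gP i)); split.
- by move=> x y; exact: mono (valP x) (valP y).
- move=> i j [eq_ij]; apply/val_inj/eqP.
  rewrite -(nth_uniq fset0 (ltn_ord i) (ltn_ord j) uF).
  apply/eqP; apply: ginj; rewrite ?nF //.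
  by rewrite -(nth_index fset0 (gH _ (nF i))) eq_ij nth_index // gH.
by move=> i v vE /=; rewrite nth_index ?gH // phig.
Qed.

(** Degree one of the leaves is recorded as injectivity of [leaf], so that an edge can be named by
    its leaf. *)
Record star_decomposition (F : hypergraph) (A B : {fset nat})
    (center leaf : {fset nat} -> nat) : Prop := StarDecomposition {
  star_uniq : uniq F;
  star_vset : vset F = (A `|` B)%fset;
  star_lt : forall a b, a \in A -> b \in B -> a < b;
  star_center : {in F, forall E, center E \in A};
  star_leaf : {in F, forall E, leaf E \in B};
  star_edge : {in F, forall E, E = [fset center E; leaf E]%fset};
  star_leaf_inj : {in F &, injective leaf} }.

Lemma star_forest_decomposition F : star_forest F ->
  exists A B center leaf, star_decomposition F A B center leaf.
Proof.
case=> /andP[/andP[_ uF] _] [A [B [VF ltAB degB edgeF]]].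
have /boolp.choice[c cP] : forall E, exists ab : nat * nat, E \in F ->
    [/\ ab.1 \in A, ab.2 \in B & E = [fset ab.1; ab.2]%fset].
  move=> E; case: (boolP (E \in F)) => [/edgeF[a [b abP]]|]; last by exists (0, 0).
  by exists (a, b).
exists A, B, (fun E => (c E).1), (fun E => (c E).2); split=> //.
- by move=> E /cP[].
- by move=> E /cP[].
- by move=> E /cP[].
move=> E E' EF E'F eq_leaf; apply/eqP/negPn/negP => EE'.
have [_ bB defE] := cP E EF; have [_ _ defE'] := cP E' E'F.
have := degB _ bB; rewrite /degree.
have : 2 <= count (fun D : {fset nat} => (c E).2 \in D) F; last by move=> h1 h2; rewrite h2 in h1.
rewrite -size_filter.
apply: (@uniq_leq_size _ [:: E; E']); first by rewrite /= inE EE'.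
move=> D; rewrite !inE mem_filter => /orP[]/eqP->; rewrite ?EF ?E'F andbT.
  by rewrite {2}defE !inE eqxx orbT.
by rewrite defE' !inE eq_leaf eqxx orbT.
Qed.

Lemma sorted_index_ltn (s : seq nat) x y : sorted ltn s -> x \in s -> y \in s ->
  x < y -> index x s < index y s.
Proof.
move=> ss xs ys xy; rewrite ltnNge leq_eqVlt; apply/negP => /orP[/eqP h|h].
  by move: xy; rewrite -(nth_index 0 xs) -h nth_index // ltnn.
by have := sorted_ltn_index ltn_trans ss _ _ ys xs h; rewrite ltnNge ltnW.
Qed.

Lemma sorted_enum_fset (A : {fset nat}) : sorted ltn (sort leq A).
Proof. by rewrite ltn_sorted_uniq_leq sort_uniq fset_uniq sort_sorted //; exact: leq_total. Qed.

Section Embedding.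
Variables (F H : hypergraph) (A B : {fset nat}) (center leaf : {fset nat} -> nat).
Hypothesis dF : star_decomposition F A B center leaf.
Variables (e : rel nat) (h : nat -> nat -> {fset nat}) (t : nat).
Hypothesis e_lt : forall x y, e x y -> x < y.
Hypothesis hP : forall x y, e x y -> [/\ h x y \in H, x \in h x y & y \in h x y].
(* [C] are candidate places for the next leaf and [U] the edges already used. *)
Hypothesis h_fresh : forall x (C : seq nat) (U : seq {fset nat}),
  uniq C -> size C = t -> {in C, forall y, e x y} -> size U < #|` B| ->
  {in U, forall E, exists x' y', [/\ e x' y', E = h x' y' & {in C, forall y, y' < y}]} ->
  exists2 y, y \in C & h x y \notin U.

Lemma star_leaf_edge b : b \in B -> exists2 E, E \in F & leaf E = b.
Proof.
move=> bB; have : b \in vset F by rewrite (star_vset dF) inE bB orbT.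
case/mem_vset => E EF; rewrite {1}(star_edge dF EF) !inE => /orP[]/eqP eb.
  by have := star_lt dF (star_center dF EF) bB; rewrite -eb ltnn.
by exists E.
Qed.

(* The leaves are placed from left to right, the [j]-th one in one of the
   [t] intervals [j t + 1, ..., (j + 1) t] of the formation; interval [0] keeps
   the centers to the left of all leaves. *)
Lemma embed_star_forest :
  vertex_formation e #|` A| (t * #|` B|).+1 -> contains H F.
Proof.
move=> [S [sel [uS cS selP sel_lt]]]; have fresh := h_fresh; set q := #|` B| in fresh selP sel_lt.
pose Ss := sort leq S; pose As := sort leq A; pose bs := sort leq B.
have sSs : sorted ltn Ss.
  by rewrite ltn_sorted_uniq_leq sort_uniq uS sort_sorted //; exact: leq_total.
have zSs : size Ss = #|` A| by rewrite size_sort.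
have zAs : size As = #|` A| by rewrite size_sort.
have zbs : size bs = q by rewrite size_sort.
have mAs a : (a \in As) = (a \in A) by rewrite mem_sort.
have mbs b : (b \in bs) = (b \in B) by rewrite mem_sort.
pose row a := nth 0 Ss (index a As).
have rowS a : a \in A -> row a \in S.
  by move=> aA; rewrite -(mem_sort leq) mem_nth // zSs -zAs index_mem mAs.
have /boolp.choice[eb ebP] : forall b, exists E, b \in B -> E \in F /\ leaf E = b.
  move=> b; case: (boolP (b \in B)) => [/star_leaf_edge[E ? ?]|]; last by exists fset0.
  by exists E.
pose w j := row (center (eb (nth 0 bs j))).
have wS j : j < q -> w j \in S.
  move=> jq; apply: rowS; apply: (star_center dF).
  by apply: (proj1 (ebP _ _)); rewrite -mbs mem_nth ?zbs.
have bound l j : j < q -> l <= j.+1 * t -> l < (t * q).+1.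
  by move=> jq lj; rewrite ltnS (leq_trans lj) // mulnC leq_mul2l jq orbT.
have [col [colP col_fresh]] : exists col : nat -> nat,
    (forall j, j < q -> exists2 l, j * t < l <= j.+1 * t & col j = sel l (w j)) /\
    (forall i j, i < j -> j < q -> h (w i) (col i) != h (w j) (col j)).
  suff: forall k, k <= q -> exists col : nat -> nat,
    (forall j, j < k -> exists2 l, j * t < l <= j.+1 * t & col j = sel l (w j)) /\
    (forall i j, i < j -> j < k -> h (w i) (col i) != h (w j) (col j)).
    exact.
  elim=> [|k IHk] kq; first by exists id.
  have [col [colP col_fresh]] := IHk (ltnW kq).
  (* The candidates are the [t] entries of row [w k] in the [k]-th interval; [h_fresh] finds one
     whose edge differs from those of the earlier leaves. *)
  pose C := [seq sel (k * t + i.+1) (w k) | i <- iota 0 t].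
  pose U := [seq h (w j) (col j) | j <- iota 0 k].
  have C_lt i : i < t -> k * t + i.+1 < (t * q).+1.
    by move=> it; apply: bound kq _; rewrite mulSn addnC leq_add2r.
  have eC : {in C, forall y, e (w k) y}.
    move=> y /mapP[i]; rewrite mem_iota add0n /= => it ->.
    by apply: selP; [exact: C_lt | exact: wS].
  have uC : uniq C.
    rewrite map_inj_in_uniq ?iota_uniq // => i j; rewrite !mem_iota !add0n /= => it jt.
    have lt i' j' : i' < j' -> j' < t -> sel (k * t + i'.+1) (w k) < sel (k * t + j'.+1) (w k).
      move=> ij jt'; apply: sel_lt; rewrite ?wS ?C_lt //.
      by rewrite ltn_add2l ltnS.
    case: (ltngtP i j) => // [/lt|/lt] h1 h2.
      by have := h1 jt; rewrite h2 ltnn.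
    by have := h1 it; rewrite h2 ltnn.
  have szC : size C = t by rewrite size_map size_iota.
  have szU : size U < q by rewrite size_map size_iota.
  have [|y yC yU] := fresh (w k) C U uC szC eC szU.
    move=> E /mapP[j]; rewrite mem_iota add0n /= => jk ->.
    have [l /andP[lj jl] cl] := colP j jk; have jq := ltn_trans jk kq.
    exists (w j), (col j); split=> //.
      by rewrite cl; apply: selP; [exact: bound jl | exact: wS].
    move=> y /mapP[i]; rewrite mem_iota add0n /= => it ->; rewrite cl.
    apply: sel_lt; rewrite ?wS ?C_lt //.
    apply: leq_ltn_trans jl _; apply: (@leq_ltn_trans (k * t)).
      by rewrite leq_mul2r jk orbT.
    by rewrite -addn1 leq_add2l.
  exists (fun j => if j == k then y else col j); split.
    move=> j; rewrite ltnS leq_eqVlt; case: eqP => [-> _|_ /= /colP //].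
    have /mapP[i] := yC; rewrite mem_iota add0n /= => it ->.
    exists (k * t + i.+1) => //; rewrite mulSn -{1}[k * t]addn0 ltn_add2l /=.
    by rewrite addnC leq_add2r.
  move=> i j ij; rewrite ltnS leq_eqVlt; case: (eqVneq j k) => [jk _|_ /= jk].
    move: ij; rewrite jk => ik; rewrite (ltn_eqF ik).
    apply: contra yU => /eqP <-; apply/mapP; exists i => //.
    by rewrite mem_iota add0n.
  by rewrite (ltn_eqF (ltn_trans ij jk)) col_fresh.
have AB v : v \in B -> v \in A = false.
  by move=> vB; apply/negP => vA; have := star_lt dF vA vB; rewrite ltnn.
have ixq b : b \in B -> index b bs < q by rewrite -mbs -index_mem zbs.
have wE E : E \in F -> w (index (leaf E) bs) = row (center E).
  move=> EF; have lB := star_leaf dF EF; rewrite /w nth_index ?mbs //.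
  have [eF le] := ebP _ lB.
  by rewrite (star_leaf_inj dF eF EF le).
have ecol j : j < q -> e (w j) (col j).
  move=> jq; have [l /andP[_ jl] ->] := colP j jq.
  by apply: selP; [exact: bound jl | exact: wS].
pose phi v := if v \in A then row v else col (index v bs).
pose g E := h (w (index (leaf E) bs)) (col (index (leaf E) bs)).
apply: (@containsI H F phi g (star_uniq dF)).
- move=> x y; rewrite (star_vset dF) !inE /phi => hx hy xy.
  case: (boolP (x \in A)) hx => [xA _|xA /= xB].
    case: (boolP (y \in A)) hy => [yA _|yA /= yB].
      apply: (sorted_ltn_nth ltn_trans) => //.
      + by rewrite inE zSs -zAs index_mem mAs.
      + by rewrite inE zSs -zAs index_mem mAs.
      by apply: sorted_index_ltn; rewrite ?mAs // sorted_enum_fset.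
    have jq := ixq y yB; have [l /andP[lj jl] ->] := colP _ jq.
    have rx := rowS x xA.
    (* The center [row x] precedes its own entry in group 0, and this entry precedes every leaf,
       whichever star the leaf belongs to. *)
    apply: ltn_trans (e_lt (selP 0 (row x) _ rx)) _ => //.
    by apply: sel_lt; rewrite ?wS //; [exact: leq_ltn_trans lj | exact: bound jl].
  case: (boolP (y \in A)) hy => [yA _|yA /= yB].
    by have := ltn_trans xy (star_lt dF yA xB); rewrite ltnn.
  have ij : index x bs < index y bs.
    by apply: sorted_index_ltn; rewrite ?mbs // sorted_enum_fset.
  have [l /andP[_ l1] ->] := colP _ (ixq x xB).
  have [l' /andP[l2 l3] ->] := colP _ (ixq y yB).
  apply: sel_lt; rewrite ?wS ?ixq //; last by apply: bound l3; exact: ixq.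
  apply: leq_ltn_trans l1 _; apply: leq_ltn_trans l2.
  by rewrite leq_mul2r ij orbT.
- by move=> E EF; have [] := hP (ecol _ (ixq _ (star_leaf dF EF))).
- move=> E v EF; rewrite {1}(star_edge dF EF) !inE /phi.
  have [_ h1 h2] := hP (ecol _ (ixq _ (star_leaf dF EF))).
  case/orP => /eqP->; first by rewrite (star_center dF EF) -wE.
  by rewrite AB ?(star_leaf dF EF).
move=> E E' EF E'F eqg; apply: (star_leaf_inj dF) => //.
have lB := star_leaf dF EF; have lB' := star_leaf dF E'F.
case: (ltngtP (index (leaf E) bs) (index (leaf E') bs)) => h1.
- by have := col_fresh _ _ h1 (ixq _ lB'); rewrite -/(g E) -/(g E') eqg eqxx.
- by have := col_fresh _ _ h1 (ixq _ lB); rewrite -/(g E) -/(g E') eqg eqxx.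
by rewrite -(nth_index 0 (_ : leaf E \in bs)) ?mbs // h1 nth_index ?mbs.
Qed.

End Embedding.

(** * Vertices, leaves and components of a star forest *)

Section StarCount.
Variables (F : hypergraph) (A B : {fset nat}) (center leaf : {fset nat} -> nat).
Hypothesis dF : star_decomposition F A B center leaf.

Lemma star_notin_center b : b \in B -> b \in A = false.
Proof. by move=> bB; apply/negP => aA; have := star_lt dF aA bB; rewrite ltnn. Qed.

Lemma star_center_edge a : a \in A -> exists2 E, E \in F & center E = a.
Proof.
move=> aA; have : a \in vset F by rewrite (star_vset dF) inE aA.
case/mem_vset => E EF; rewrite {1}(star_edge dF EF) !inE => /orP[]/eqP ea; first by exists E.
by have := star_notin_center (star_leaf dF EF); rewrite -ea aA.
Qed.

Lemma star_not_center v : v \in vset F -> v \notin A -> v \in B.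
Proof. by rewrite (star_vset dF) inE => /orP[->|]. Qed.

Lemma star_nvert : nvert F = #|` A| + #|` B|.
Proof.
rewrite /nvert (star_vset dF) cardfsU (_ : (A `&` B)%fset = fset0) ?cardfs0 ?subn0 //.
by apply/fsetP => x; rewrite !inE; apply/negP => /andP[xA /star_notin_center]; rewrite xA.
Qed.

Lemma star_center_le_leaf : #|` A| <= #|` B|.
Proof.
have /boolp.choice[f fP] : forall a, exists E, a \in A -> E \in F /\ center E = a.
  move=> a; case: (boolP (a \in A)) => [/star_center_edge[E]|]; last by exists fset0.
  by exists E.
have uA := fset_uniq A.
rewrite -(size_map (fun a => leaf (f a))); apply: uniq_leq_size.
  rewrite map_inj_in_uniq // => x y xA yA eq_l.
  have [fx <-] := fP x xA; have [fy <-] := fP y yA.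
  by rewrite (star_leaf_inj dF fx fy eq_l).
by move=> b /mapP[a aA ->]; apply: (star_leaf dF); case: (fP a aA).
Qed.

(** The map [cen] to the center of the star is constant on components, and every vertex is connected
    to its image; so the roots of components correspond to the elements of [A]. *)
Lemma star_ncomponents : ncomponents F = #|` A|.
Proof.
have /boolp.choice[eb ebP] : forall b, exists E, b \in B -> E \in F /\ leaf E = b.
  move=> b; case: (boolP (b \in B)) => [/(star_leaf_edge dF)[E ? ?]|]; last by exists fset0.
  by exists E.
pose cen (v : vset F) := if val v \in A then val v else center (eb (val v)).
have cenE E (v : vset F) : E \in F -> val v \in E -> cen v = center E.
  move=> EF; rewrite {1}(star_edge dF EF) !inE /cen => /orP[]/eqP->.
    by rewrite (star_center dF EF).
  have lB := star_leaf dF EF; rewrite star_notin_center //.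
  by have [eF le] := ebP _ lB; rewrite (star_leaf_inj dF eF EF le).
pose e := @adjacent F.
have e_sym : connect_sym e.
  apply: sym_connect_sym => x y; apply: eq_has => E; exact: andbC.
have cen_connect x y : connect e x y -> cen x = cen y.
  have cl : closed e [pred z | cen z == cen x].
    move=> u v /hasP[E EF /andP[uE vE]].
    by rewrite !inE (cenE E u) // (cenE E v).
  by move=> /(closed_connect cl); rewrite !inE eqxx => /esym/eqP.
have connect_cen x y : cen x = cen y -> connect e x y.
  suff toA z : exists2 z', val z' = cen z & connect e z z'.
    move=> exy; have [x' vx cx] := toA x; have [y' vy cy] := toA y.
    have xy' : x' = y' by apply: val_inj; rewrite vx vy.
    by apply: connect_trans cx _; rewrite xy' e_sym.
  rewrite /cen; case: (boolP (val z \in A)) => zA; first by exists z.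
  have zB : val z \in B by exact: star_not_center (valP z) zA.
  have [eF le] := ebP _ zB.
  have cE : center (eb (val z)) \in eb (val z).
    by rewrite {2}(star_edge dF eF) !inE eqxx.
  have cV : center (eb (val z)) \in vset F by apply/mem_vset; exists (eb (val z)).
  exists [` cV]%fset => //; apply: connect1; apply/hasP; exists (eb (val z)) => //.
  by rewrite cE andbT (star_edge dF eF) !inE le eqxx orbT.
rewrite /ncomponents /n_comp_mem -/e.
rewrite cardE -(size_map cen); apply/perm_size/uniq_perm => //.
  rewrite map_inj_in_uniq ?enum_uniq // => x y; rewrite !mem_enum !inE !andbT.
  move=> /eqP rx /eqP ry /connect_cen cxy.
  by rewrite -rx -ry; apply/eqP; rewrite root_connect.
move=> a; apply/mapP/idP => [[x _ ->]|aA].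
  rewrite /cen; case: (boolP (val x \in A)) => // xA.
  have xB : val x \in B by exact: star_not_center (valP x) xA.
  by apply: (star_center dF); have [] := ebP _ xB.
have aV : a \in vset F by rewrite (star_vset dF) inE aA.
exists (fingraph.root e [` aV]%fset); first by rewrite mem_enum !inE roots_root.
by rewrite -(cen_connect _ _ (connect_root e [` aV]%fset)) /cen /= aA.
Qed.

End StarCount.

(** * Graphs avoiding a star forest *)

Lemma alpha_ge n : n <= ackermann (alpha n).
Proof. by rewrite /alpha; case: ex_minnP => m /andP[]. Qed.

(** [ackermann 1] is 2, whence the recurring condition [2 < n]. *)
Lemma alpha_gt1 n : 2 < n -> 1 < alpha n.
Proof.
by rewrite /alpha; case: ex_minnP => -[|[|m]] // /andP[_] nA _ n2; have := leq_trans n2 nA.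
Qed.

Lemma card_fset_filter (K : choiceType) (A : {fset K}) (P : pred K) :
  #|` [fset x in A | P x]%fset| = \sum_(x <- A) P x.
Proof. by rewrite -sum1_size big_fset /= big_mkcond. Qed.

Lemma graph_edge_pair (E : {fset nat}) : #|` E| = 2 ->
  exists x y, x < y /\ E = [fset x; y]%fset.
Proof.
move=> E2; have [x xE] : exists x, x \in E by apply/fset0Pn; rewrite -cardfs_gt0 E2.
have := E2; rewrite (cardfsD1 x) xE => -[] /eqP /cardfs1P[y Ey].
have : y \in (E `\ x)%fset by rewrite Ey inE.
rewrite !inE => /andP[yx yE].
have eqE : E = [fset x; y]%fset by rewrite -(fsetD1K xE) Ey.
case: (ltngtP x y) => xy; first by exists x, y.
  by exists y, x; split=> //; rewrite eqE fsetUC.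
by rewrite xy eqxx in yx.
Qed.

Section Graph.
Variables (F : hypergraph) (A B : {fset nat}) (center leaf : {fset nat} -> nat).
Hypothesis dF : star_decomposition F A B center leaf.

Lemma star_free_graph_bound (G : hypergraph) n :
  simple_graph G -> 0 < #|` A| -> 2 < n -> avoiding F n G ->
  nedge G <= density #|` A| #|` B|.+1 (alpha n) * n.
Proof.
move=> /andP[/andP[_ uG] G2] A0 n2 [Gn GF].
pose e x y := (x < y) && ([fset x; y]%fset \in G).
have fr : ~ vertex_formation e #|` A| #|` B|.+1.
  (* In a graph one candidate per leaf suffices, [t = 1]: both ends of an edge used before lie to
     the left of the candidate [c]. *)
  rewrite -[#|` B|]mul1n => vf; apply: GF.
  apply: (@embed_star_forest F G A B center leaf dF e (fun x y => [fset x; y]%fset) 1) vf.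
  - by move=> x y /andP[].
  - by move=> x y /andP[_ ->]; rewrite !inE !eqxx orbT.
  move=> x [|c [|//]] U // _ _ ec _ UP; exists c; first by rewrite inE.
  apply/negP => /UP[x' [y' [/andP[xy' _] /fsetP/(_ c) eqc lt_c]]].
  have cc : c \in [:: c] by rewrite inE.
  have y'c := lt_c c cc.
  move: eqc; rewrite !inE eqxx orbT => /esym/orP[]/eqP h.
    by have := ltn_trans xy' y'c; rewrite h ltnn.
  by rewrite h ltnn in y'c.
have := sparse A0 (alpha_gt1 n2) (leq_trans Gn (alpha_ge n)) fr.
set W := vset G => bd; apply: leq_trans (leq_trans bd _); last by rewrite leq_mul2l Gn orbT.
pose prs := [seq (x, y) | x <- W, y <- W].
rewrite (_ : \sum_(x <- W) _ = count (fun z => e z.1 z.2) prs); last first.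
  by rewrite /prs -sum1_count [RHS]big_mkcond big_allpairs.
rewrite -size_filter -(size_map (fun z : nat * nat => [fset z.1; z.2]%fset)).
apply: uniq_leq_size uG _ => E EG.
have cE2 : #|` E| = 2 by apply/eqP; move: E EG; exact/allP.
have [x [y [xy eqE]]] := graph_edge_pair cE2.
apply/mapP; exists (x, y) => //; rewrite mem_filter /= /e xy -eqE EG /=.
have EW z : z \in E -> z \in W by move=> zE; apply/mem_vset; exists E.
by apply/allpairsP; exists (x, y); rewrite !EW // eqE !inE eqxx ?orbT.
Qed.

End Graph.

(** * Degeneracy and the number of cliques *)

Section Cliques.
Variables (e : rel nat) (d N : nat).
Hypothesis e_lt : forall x y, e x y -> x < y.
Hypothesis e_sparse : forall W : {fset nat}, #|` W| <= N ->
  \sum_(x <- W) \sum_(y <- W) e x y <= d * #|` W|.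

Definition clique (K : {fset nat}) :=
  all (fun x => all (fun y => (x < y) ==> e x y) K) K.

Definition cliques k (W : {fset nat}) : {fset {fset nat}} :=
  [fset K in fpowerset W | clique K && (#|` K| == k)]%fset.

Definition neighbours v (W : {fset nat}) : {fset nat} :=
  [fset y in W | e v y || e y v]%fset.

Lemma cliqueP K : reflect {in K &, forall x y, x < y -> e x y} (clique K).
Proof.
apply: (iffP allP) => [h x y xK yK|h x xK]; first by have /allP/(_ y yK)/implyP := h x xK.
by apply/allP => y yK; apply/implyP; exact: h.
Qed.

(** Summing degrees counts each related pair from both ends, so the average degree is at most
    [2 * d]. *)
Lemma low_degree (W : {fset nat}) : W != fset0 -> #|` W| <= N ->
  exists2 v, v \in W & #|` neighbours v W| <= 2 * d.
Proof.
move=> W0 WN.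
have [//|no] := pselect (exists2 v, v \in W & #|` neighbours v W| <= 2 * d).
have : \sum_(v <- W) #|` neighbours v W| <= 2 * d * #|` W|.
  apply: (@leq_trans (\sum_(v <- W) \sum_(y <- W) (e v y + e y v))).
    apply: leq_sum => v _; rewrite card_fset_filter.
    by apply: leq_sum => y _; case: (e v y); case: (e y v).
  under eq_bigr do rewrite big_split.
  rewrite big_split /= [X in _ + X]exchange_big /= addnn -mul2n -mulnA leq_mul2l.
  exact: e_sparse.
have : (2 * d).+1 * #|` W| <= \sum_(v <- W) #|` neighbours v W|.
  rewrite -sum1_size big_distrr /= big_seq [leqRHS]big_seq muln1.
  apply: leq_sum => v vW; rewrite ltnNge; apply/negP => h; apply: no; by exists v.
move=> h1 h2; have := leq_trans h1 h2.
by rewrite leq_mul2r ltnn orbF cardfs_eq0 (negbTE W0).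
Qed.

Lemma card_cliques0 W : #|` cliques 0 W| <= 1.
Proof.
rewrite -(cardfs1 (fset0 : {fset nat})); apply: fsubset_leq_card.
by apply/fsubsetP => K; rewrite !inE => /and3P[_ _]; rewrite cardfs_eq0.
Qed.

(** A clique through [v] is determined by its other vertices, which form a clique among the
    neighbours of [v]. *)
Lemma card_cliquesS k v (W : {fset nat}) :
  #|` cliques k.+1 W| <=
    #|` cliques k.+1 (W `\ v)%fset| + #|` cliques k (neighbours v W)|.
Proof.
pose add_v (K : {fset nat}) := (v |` K)%fset.
apply: leq_trans (_ : #|` cliques k.+1 (W `\ v) `|` [fset add_v K | K in cliques k (neighbours v W)]|%fset <= _);
  last by rewrite cardfsU (leq_trans (leq_subr _ _)) // leq_add2l leq_imfset_card.
apply: fsubset_leq_card; apply/fsubsetP => K.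
rewrite !inE /= fpowersetE => /and3P[KW cK /eqP zK].
case: (boolP (v \in K)) => vK.
  apply/orP; right; apply/imfsetP; exists (K `\ v)%fset; last by rewrite /add_v fsetD1K.
  have vKK : (K `\ v `<=` K)%fset by exact: fsubD1set.
  rewrite !inE fpowersetE; apply/and3P; split.
  - apply/fsubsetP => y; rewrite !inE => /andP[yv yK]; rewrite (fsubsetP KW y yK) /=.
    case: (ltngtP y v) yv => // h _.
      by rewrite (cliqueP K cK _ _ yK vK h) orbT.
    by rewrite (cliqueP K cK _ _ vK yK h).
  - by apply/cliqueP => x y /(fsubsetP vKK) xK /(fsubsetP vKK); exact: (cliqueP K cK).
  by rewrite -eqSS -zK (cardfsD1 v K) vK.
apply/orP; left; rewrite cK zK eqxx !andbT fpowersetE.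
by apply/fsubsetP => y yK; rewrite !inE (fsubsetP KW y yK) andbT; apply: contraNneq vK => <-.
Qed.

(** Vertices of low degree are peeled off one at a time; induction on [k] in the neighbourhood shows
    that each removal destroys at most [(2 * d) ^ k] cliques. *)
Lemma card_cliques k (W : {fset nat}) : #|` W| <= N ->
  #|` cliques k.+1 W| <= #|` W| * (2 * d) ^ k.
Proof.
elim: k W => [|k IHk] W; move En : #|` W| => n; elim: n W En => [|n IHn] W Wn WN;
  try (rewrite mul0n leqn0 cardfs_eq0; apply/eqP/fsetP => K; rewrite !inE fpowersetE;
    apply/negP => /and3P[/fsubset_leq_card]; by rewrite Wn leqn0 => /eqP->).
all: have W0 : W != fset0 by rewrite -cardfs_eq0 Wn.
all: have [v vW dv] := low_degree W0 (leq_trans (eq_leq Wn) WN).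
all: have Wv : #|` (W `\ v)%fset| = n by move: Wn; rewrite (cardfsD1 v) vW => -[].
all: apply: leq_trans (card_cliquesS _ v W) _; rewrite mulSn addnC.
all: apply: leq_add (IHn _ Wv (ltnW WN)).
  exact: card_cliques0.
have nN : #|` neighbours v W| <= N.
  by apply: leq_trans WN; rewrite -Wn; apply: fsubset_leq_card; exact: fset_sub.
by apply: leq_trans (IHk _ nN) _; rewrite expnS leq_mul2r dv orbT.
Qed.

End Cliques.

(** * Hypergraphs avoiding a star forest *)

Section Near.
Variable p : nat.
Hypothesis p_gt0 : 0 < p.

(* Distance less than [p] in the increasing enumeration of [E]. *)
Definition near_in (E : {fset nat}) x y :=
  [&& x \in E, y \in E, x < y & #|` [fset z in E | x < z <= y]%fset| < p].

Definition tight (E K : {fset nat}) := clique (near_in E) K.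

Definition tight_subsets (E : {fset nat}) : {fset {fset nat}} :=
  [fset K in fpowerset E | tight E K && (#|` K| == minn p #|` E|)]%fset.

Lemma seq_max (s : seq nat) : s != [::] ->
  exists2 m, m \in s & {in s, forall x, x <= m}.
Proof.
elim: s => // a [|b s] IH _; first by exists a => [|x]; rewrite inE // => /eqP->.
have [//|m ms mP] := IH; exists (maxn a m).
  by rewrite /maxn; case: ifP => _; rewrite inE ?ms ?eqxx ?orbT.
by move=> x; rewrite inE => /orP[/eqP->|/mP]; rewrite leq_max ?leqnn // => ->; rewrite orbT.
Qed.

(** All of [C] lies after [x] and up to its largest element [m]; as [m] is near [x], fewer than [p]
    vertices of [E] fit there. *)
Lemma near_in_size (E : {fset nat}) x (C : seq nat) :
  uniq C -> {in C, forall y, near_in E x y} -> size C < p.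
Proof.
case: (eqVneq C [::]) => [-> //|/seq_max[m mC mP] uC nC].
have /and4P[_ _ _] := nC m mC; apply: leq_ltn_trans.
apply: uniq_leq_size uC _ => y yC; have /and4P[_ yE xy _] := nC y yC.
by rewrite !inE yE xy mP.
Qed.

Lemma initial_subset (E : {fset nat}) k : k <= #|` E| ->
  exists K : {fset nat}, [/\ (K `<=` E)%fset, #|` K| = k
    & forall x z, x \in K -> z \in E -> z <= x -> z \in K].
Proof.
elim: k => [_|k IHk kE].
  by exists fset0; split; rewrite ?fsub0set ?cardfs0 // => x z; rewrite inE.
have [K [KE cK iK]] := IHk (ltnW kE).
have /fset0Pn exD : (E `\` K)%fset != fset0.
  rewrite -cardfs_gt0 cardfsD (fsetIidPr KE) cK subn_gt0; exact: kE.
case: (ex_minnP exD) => m; rewrite !inE => /andP[mK mE] min_m.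
exists (m |` K)%fset; split.
- by apply/fsubsetP => x; rewrite !inE => /orP[/eqP->|/(fsubsetP KE)].
- by rewrite cardfsU1 mK cK.
move=> x z; rewrite !inE => xmK zE zx; case: (boolP (z \in K)); rewrite ?orbT // => zK.
have mz : m <= z by apply: min_m; rewrite !inE zK zE.
case/orP: xmK => [/eqP xm|xK]; first by rewrite eqn_leq mz -xm zx.
by rewrite (iK x z xK zE zx) in zK.
Qed.

(** The vertices [x < z <= y] of [E] all belong to the initial segment [K] and differ from [x], so
    there are fewer than [p] of them. *)
Lemma initial_tight (E K : {fset nat}) : (K `<=` E)%fset -> #|` K| <= p ->
  (forall x z, x \in K -> z \in E -> z <= x -> z \in K) -> tight E K.
Proof.
move=> KE Kp iK; apply/cliqueP => x y xK yK xy.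
apply/and4P; split; rewrite ?(fsubsetP KE) //.
apply: leq_trans Kp; rewrite [ltnRHS](cardfsD1 x) xK ltnS.
apply: fsubset_leq_card; apply/fsubsetP => z; rewrite !inE => /and3P[zE xz zy].
by rewrite (iK y z yK zE zy) andbT; apply: contraTneq xz => ->; rewrite ltnn.
Qed.

(** Induction by removing the least vertex [m]: tight subsets of the rest stay tight, and the first
    [p] vertices of [E] give a new one, containing [m]. Once at most [p] vertices are left, the edge
    itself is tight. *)
Lemma card_tight_subsets (E : {fset nat}) : #|` E| <= p * #|` tight_subsets E|.
Proof.
move En : #|` E| => n; elim: n E En => [//|n IHn] E En.
have [np|pn] := leqP n.+1 p.
  apply: (leq_trans np); apply: leq_pmulr; rewrite cardfs_gt0.
  apply/fset0Pn; exists E; rewrite !inE fpowersetE fsubset_refl /= En (minn_idPr np) eqxx andbT.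
  by apply: initial_tight => //; rewrite En.
have /fset0Pn exE : E != fset0 by rewrite -cardfs_gt0 En.
case: (ex_minnP exE) => m mE min_m.
pose E' := (E `\ m)%fset.
have En' : #|` E'| = n by move: En; rewrite (cardfsD1 m) mE => -[].
have [K [KE cK iK]] : exists K : {fset nat}, [/\ (K `<=` E)%fset, #|` K| = p
    & forall x z, x \in K -> z \in E -> z <= x -> z \in K].
  by apply: initial_subset; rewrite En ltnW.
have mK : m \in K.
  have /fset0Pn[x xK] : K != fset0 by rewrite -cardfs_gt0 cK.
  by apply: (iK x) => //; apply: min_m; exact: (fsubsetP KE).
have sub : (K |` tight_subsets E' `<=` tight_subsets E)%fset.
  apply/fsubsetP => K'; rewrite !inE => /orP[/eqP->|].
    rewrite fpowersetE KE cK En (minn_idPl (ltnW pn)) eqxx andbT.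
    by apply: initial_tight => //; rewrite cK.
  rewrite !fpowersetE En' En (minn_idPl (pn : p <= n)) (minn_idPl (ltnW pn)).
  case/and3P => KE' /cliqueP tK ->.
  have E'E : (E' `<=` E)%fset by exact: fsubD1set.
  rewrite (fsubset_trans KE' E'E) andbT; apply/cliqueP => x y xK yK xy.
  have /and4P[xE yE _ h] := tK x y xK yK xy; apply/and4P; split; rewrite ?(fsubsetP E'E) //.
  apply: leq_ltn_trans h; apply: fsubset_leq_card; apply/fsubsetP => z.
  rewrite !inE => /and3P[zE xz zy]; rewrite zE xz zy !andbT.
  by apply: contraTneq xz => ->; rewrite -leqNgt; apply: min_m; exact: (fsubsetP E'E).
apply: leq_trans (leq_mul (leqnn p) (fsubset_leq_card sub)).
rewrite cardfsU1 (_ : K \notin tight_subsets E'); last first.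
  rewrite !inE fpowersetE; apply/negP => /andP[/fsubsetP/(_ m mK)].
  by rewrite !inE eqxx.
rewrite mulnDr muln1; have := IHn E' En'; lia.
Qed.

End Near.

Lemma size_le_fibers (T U : eqType) (f : T -> U) (C : seq T) (V : seq U) d :
  {in C, forall y, f y \in V} -> (forall v, count (fun y => f y == v) C <= d) ->
  size C <= size V * d.
Proof.
elim: V C => [|v V IHV] C CV Cd.
  by case: C CV {Cd} => // y C /(_ y); rewrite !inE eqxx => /(_ isT).
rewrite -(count_predC (fun y => f y == v)) mulSn leq_add // -size_filter.
apply: IHV => [y|v']; first by rewrite mem_filter => /andP[/= /negbTE h /CV]; rewrite inE h.
by rewrite count_filter; apply: leq_trans (Cd v'); apply: sub_count => y /andP[].
Qed.

(** The increasing bijection from the vertices of [F] to [K] sends every edge of [F] inside [K], so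
    the edges of [F] may go to any distinct edges containing [K]. *)
Lemma contains_common_subset (H F : hypergraph) (K : {fset nat}) :
  uniq F -> uniq H -> #|` K| = nvert F ->
  size F <= count (fun E : {fset nat} => (K `<=` E)%fset) H -> contains H F.
Proof.
move=> uF uH cK; rewrite -size_filter; set Hs := seq.filter _ H => FH.
pose Ks := sort leq K; pose Vs := sort leq (vset F).
have zK : size Ks = size Vs by rewrite !size_sort.
have mVs v : (v \in Vs) = (v \in vset F) by rewrite mem_sort.
pose g E := nth fset0 Hs (index E F).
have gHs E : E \in F -> g E \in Hs.
  by move=> EF; apply: mem_nth; apply: leq_trans FH; rewrite index_mem.
have uHs : uniq Hs by rewrite filter_uniq.
apply: (@containsI H F (fun v => nth 0 Ks (index v Vs)) g) => //.
- move=> x y xV yV xy; apply: (sorted_ltn_nth ltn_trans); rewrite ?sorted_enum_fset //.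
  + by rewrite inE zK index_mem mVs.
  + by rewrite inE zK index_mem mVs.
  by apply: (sorted_index_ltn (sorted_enum_fset _)); rewrite ?mVs.
- by move=> E /gHs; rewrite mem_filter => /andP[].
- move=> E v EF vE; have := gHs E EF; rewrite mem_filter => /andP[/fsubsetP sub _].
  apply: sub; rewrite -(mem_sort leq) mem_nth // zK index_mem mVs.
  by apply/mem_vset; exists E.
move=> E E' EF E'F /eqP; rewrite nth_uniq //.
- by move=> /eqP h; rewrite -(nth_index fset0 EF) h nth_index.
- by apply: leq_trans FH; rewrite index_mem.
by apply: leq_trans FH; rewrite index_mem.
Qed.

Section Hypergraph.
Variables (F : hypergraph) (A B : {fset nat}) (center leaf : {fset nat} -> nat).
Hypothesis dF : star_decomposition F A B center leaf.
Variables (H : hypergraph) (n t : nat).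
Let p := nvert F.
Let q := #|` B|.
Hypotheses (A_gt0 : 0 < #|` A|) (n_gt2 : 2 < n).
Hypothesis sH : simple_hypergraph H.
Hypothesis avH : avoiding F n H.
Hypothesis tE : t = (p - 1) * (q - 1) + 1.

Let e x y := has (fun E => near_in p E x y) H.
Let h x y := nth fset0 H (find (fun E => near_in p E x y) H).

Let p_gt0 : 0 < p.
Proof. by rewrite /p (star_nvert dF) ltn_addr. Qed.

Let e_lt x y : e x y -> x < y.
Proof. by case/hasP => E _ /and4P[]. Qed.

Let h_near x y : e x y -> near_in p (h x y) x y.
Proof. by move=> exy; apply: (@nth_find _ fset0 (fun E => near_in p E x y)). Qed.

Let h_mem x y : e x y -> h x y \in H.
Proof. by move=> exy; rewrite mem_nth // -has_find. Qed.

Let no_formation : ~ vertex_formation e #|` A| (t * q).+1.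
Proof.
move=> vf; case: avH => _; apply.
apply: (@embed_star_forest F H A B center leaf dF e h t) vf => //.
  by move=> x y exy; have /and4P[? ? _ _] := h_near exy; split=> //; exact: h_mem.
move=> x C U uC zC eC Uq _.
have [//|no] := pselect (exists2 y, y \in C & h x y \notin U).
(* If no candidate were fresh, each of the at most [q - 1] used edges would account for at most
   [p - 1] candidates, too few for [t]. *)
have : size C <= size U * p.-1.
  apply: (@size_le_fibers _ _ (h x)) => [y yC|E].
    by apply/negPn/negP => hU; apply: no; exists y.
  rewrite -size_filter -ltnS (prednK p_gt0); apply: (@near_in_size p p_gt0 E x).
    by rewrite filter_uniq.
  by move=> y; rewrite mem_filter => /andP[/eqP<- /eC/h_near].
have : size U * p.-1 <= (q - 1) * p.-1.
  by rewrite leq_mul2r; apply/orP; right; move: Uq; rewrite -/q; lia.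
rewrite zC tE; move=> h1 h2; have := leq_trans h2 h1.
by rewrite subn1 mulnC addn1 ltnn.
Qed.

Let D := 2 * density #|` A| (t * q).+1 (alpha n).

Let card_cliques_H k : #|` cliques e k.+1 (vset H)| <= n * D ^ k.
Proof.
have [Hn _] := avH.
apply: leq_trans (_ : nvert H * D ^ k <= _); last by rewrite leq_mul2r Hn orbT.
apply: (@card_cliques e _ n) => // W Wn.
exact: sparse A_gt0 (alpha_gt1 n_gt2) (leq_trans Wn (alpha_ge n)) no_formation.
Qed.

Let mem_tight_cliques E K : E \in H -> K \in tight_subsets p E ->
  K \in cliques e (minn p #|` E|).-1.+1 (vset H).
Proof.
move=> EH; rewrite !inE !fpowersetE => /and3P[KE /cliqueP tK /eqP->].
have E0 : 0 < #|` E|.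
  by case/andP: sH => /allP/(_ E EH) E0 _; rewrite cardfs_gt0.
rewrite prednK ?eqxx ?andbT; last by rewrite leq_min p_gt0.
rewrite (fsubset_trans KE (sub_vset EH)) /=; apply/cliqueP => x y xK yK xy.
by apply/hasP; exists E => //; exact: tK.
Qed.

(** A [K] with fewer than [p] vertices can only come from the edge [K] itself, and none has more
    than [p]. If it has exactly [p], more than [q] edges containing it would yield a copy of [F]. *)
Let tight_multiplicity K : count (fun E => K \in tight_subsets p E) H <= q.
Proof.
have [_ uH] := andP sH; have [_ HF] := avH.
have uF := star_uniq dF.
have Fq : size F <= q.
  rewrite -(size_map leaf); apply: uniq_leq_size.
    by rewrite map_inj_in_uniq //; exact: star_leaf_inj dF.
  by move=> b /mapP[E EF ->]; exact: star_leaf dF E EF.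
have q0 : 0 < q by apply: leq_trans A_gt0 (star_center_le_leaf dF).
case: (ltngtP #|` K| p) => Kp.
- apply: leq_trans q0; rewrite -(leq_add2r 0) addn0.
  apply: leq_trans (_ : count_mem K H <= _); last by rewrite count_uniq_mem // leq_b1.
  apply: sub_count => E /=; rewrite !inE fpowersetE => /and3P[KE _ /eqP cK].
  have : #|` E| <= #|` K| by rewrite cK leq_min leqnn andbT; move: cK Kp; rewrite /minn; case: ltnP => // _ ->; rewrite ltnn.
  by move=> cEK; rewrite eq_sym eqEfcard KE.
- rewrite (@eq_in_count _ _ pred0) ?count_pred0 // => E EH /=.
  apply/negbTE; rewrite !inE; apply/negP => /and3P[_ _ /eqP cK].
  by move: Kp; rewrite cK ltnNge geq_minl.
rewrite leqNgt; apply/negP => lt; apply: HF.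
apply: (contains_common_subset uF uH Kp).
apply: leq_trans Fq (leq_trans (ltnW lt) _).
by apply: sub_count => E; rewrite !inE fpowersetE => /andP[].
Qed.

(** Pairs of an edge and a tight subset are counted in two ways. The first [p] comes from
    [card_tight_subsets], [q] from [tight_multiplicity], the second [p] from the possible clique
    sizes collected in [L]. *)
Lemma star_free_incidence_bound : nincid H <= p * q * p * (n * D ^ p).
Proof.
pose L := flatten [seq enum_fset (cliques e k.+1 (vset H)) | k <- iota 0 p].
have D0 : 0 < D by rewrite !muln_gt0 expn_gt0 muln_gt0 A_gt0.
have zL : size L <= p * (n * D ^ p).
  rewrite size_flatten sumnE /shape -map_comp big_map.
  apply: leq_trans (_ : \sum_(k <- iota 0 p) n * D ^ p <= _).
    rewrite big_seq [leqRHS]big_seq; apply: leq_sum => k; rewrite mem_iota add0n => /= kp.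
    apply: leq_trans (card_cliques_H k) _.
    by rewrite leq_mul2l leq_pexp2l ?orbT // ltnW.
  by rewrite big_const_seq count_predT size_iota iter_addn_0 mulnC.
have mem_L E K : E \in H -> K \in tight_subsets p E -> K \in L.
  move=> EH KE; apply/flattenP; exists (enum_fset (cliques e (minn p #|` E|).-1.+1 (vset H))).
    apply: (map_f (fun k => enum_fset (cliques e k.+1 (vset H)))); rewrite mem_iota add0n; apply: leq_ltn_trans (_ : p.-1 < p).
      by rewrite -!subn1 leq_sub2r // geq_minl.
    by rewrite prednK.
  exact: mem_tight_cliques.
apply: (@leq_trans (\sum_(E <- H) p * \sum_(K <- L) (K \in tight_subsets p E))).
  rewrite /nincid big_seq [leqRHS]big_seq; apply: leq_sum => E EH.
  apply: leq_trans (card_tight_subsets p_gt0 E) _; rewrite leq_mul2l; apply/orP; right.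
  have -> : \sum_(K <- L) (K \in tight_subsets p E) = count (fun K => K \in tight_subsets p E) L.
    by rewrite -sum1_count [RHS]big_mkcond.
  rewrite -size_filter; apply: uniq_leq_size (fset_uniq _) _ => K KE.
  by rewrite mem_filter KE (mem_L E).
rewrite -big_distrr /= exchange_big /= -!mulnA leq_mul2l; apply/orP; right.
apply: leq_trans (leq_mul (leqnn q) zL); rewrite mulnC -sum1_size big_distrl /=.
by apply: leq_sum => K _; rewrite mul1n; apply: leq_trans (tight_multiplicity K); rewrite -sum1_count [leqRHS]big_mkcond.
Qed.

End Hypergraph.

(** * Comparison of the densities with [beta], and conclusion *)

Lemma add2_le_expn2 q : 1 < q -> q.+2 <= 2 ^ q.
Proof. by elim: q => [|[|[|q]] IH] // _; rewrite expnS; have := IH isT; lia. Qed.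

(** As [r >= 2], the first power of [alpha n] in [beta] has exponent at least [4 * q - 4]; its
    excess [3 * q - 5] over [q.+1], with the coefficient 2, absorbs the factor [q.+2]. *)
Lemma density_le_beta r q n : 1 < r -> 1 < q -> 2 < n ->
  density r q.+1 (alpha n) <= beta r (2 * q) n.
Proof.
move=> r1 q1 n2; have a1 := alpha_gt1 n2; rewrite /density /beta.
set a := alpha n in a1 *; have a0 := ltnW a1.
have rq : 4 * q <= r * (2 * q) by rewrite mulnA leq_mul2r; lia.
apply: leq_mul.
  apply: (@leq_trans (2 ^ 2)) => //; apply: leq_trans (leq_pmull _ (ltnW r1)).
  by rewrite leq_exp2l //; lia.
apply: (@leq_trans ((10 * r) ^ (q.+2 * a ^ q.+1))).
  by rewrite leq_exp2r ?leq_mul2r ?orbT // muln_gt0 expn_gt0 a0.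
rewrite leq_pexp2l ?muln_gt0 ?(ltnW r1) //; apply: leq_trans (leq_addr _ _).
apply: (@leq_trans (2 * a ^ (4 * q - 4))); last first.
  by rewrite leq_mul2l leq_pexp2l //= leq_sub2r.
have -> : 4 * q - 4 = (3 * q - 5) + q.+1 by lia.
rewrite expnD mulnA leq_mul2r; apply/orP; right.
apply: (@leq_trans (2 * 2 ^ (3 * q - 5))).
  apply: leq_trans (add2_le_expn2 q1) _; rewrite -expnS leq_exp2l //; lia.
rewrite leq_mul2l leq_exp2r //; lia.
Qed.

(** [6 ^ p] gathers the factors 2 and 3 of the doubled density. With [X = t * q], both [X.+2] and
    [p] are at most [2 ^ X], so the remaining exponent is at most [a ^ (3 * X + 1)], and
    [3 * X + 1 <= 4 * X - 4]. *)
Lemma density_pow_le_beta p r q t n : 1 < r -> 1 < q -> p <= t -> 3 < p -> 2 < n ->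
  (2 * density r (t * q).+1 (alpha n)) ^ p <= 6 ^ p * beta r (2 * t * q) n ^ 3.
Proof.
move=> r1 q1 pt p3 n2; have a1 := alpha_gt1 n2; rewrite /density /beta.
set a := alpha n in a1 *; have a0 := ltnW a1; rewrite -[2 * t * q]mulnA.
set X := t * q.
have pX : p <= X by apply: leq_trans pt _; rewrite leq_pmulr // ltnW.
have X8 : 8 <= X by rewrite -[8]/(4 * 2) leq_mul // (leq_trans p3).
have rX : 4 * X <= r * (2 * X) by rewrite mulnA leq_mul2r; lia.
rewrite mulnA (expnMn 6) leq_mul2l -expnM; apply/orP; right.
apply: (@leq_trans ((10 * r) ^ (X.+2 * a ^ X.+1 * p))).
  rewrite leq_exp2r ?leq_mul2r ?orbT // !muln_gt0 expn_gt0 a0 /=; lia.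
set Y := (10 * r) ^ (_ + _).
have Y0 : 0 < Y by rewrite expn_gt0 muln_gt0 (ltnW r1).
set Z := r * 2 ^ _.
have Z0 : 0 < Z by rewrite muln_gt0 expn_gt0 (ltnW r1).
apply: (@leq_trans Y); last first.
  apply: leq_trans (leq_pmull Y Z0) _; rewrite -{1}[Z * Y]expn1 leq_pexp2l //.
  by rewrite muln_gt0 Z0.
rewrite leq_pexp2l ?muln_gt0 ?(ltnW r1) //; apply: leq_trans (leq_addr _ _).
apply: leq_trans (leq_pmull _ (isT : 0 < 2)).
apply: (@leq_trans (a ^ (X + X + X.+1))); last by rewrite leq_pexp2l //; lia.
rewrite mulnAC expnD leq_mul2r expnD; apply/orP; right.
have aX : 2 ^ X <= a ^ X by rewrite leq_exp2r //; lia.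
apply: leq_mul; apply: leq_trans aX; first by apply: add2_le_expn2; lia.
by apply: leq_trans pX _; rewrite ltnW // ltn_expl.
Qed.

Lemma nedge_le_nincid H : simple_hypergraph H -> nedge H <= nincid H.
Proof.
move=> /andP[/allP H0 _]; rewrite /nedge -sum1_size /nincid big_seq [leqRHS]big_seq.
by apply: leq_sum => E EH; rewrite cardfs_gt0 H0.
Qed.

Theorem theorem6 (R : realType) (F : hypergraph) (r p q t : nat)
    (hF : star_forest F)
    (hr : ncomponents F = r) (r_gt1 : (1 < r)%N)
    (hp : nvert F = p)
    (hq : q = (p - r)%N)
    (ht : t = ((p - 1) * (q - 1) + 1)%N) :
  [/\ forall n : nat, (0 < n)%N ->
        (gex F n < (r - 1) * n + n * beta r (2 * q) n)%N,
      vinogradov (fun n => (ex_e F n)%:R : R)%R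
                 (fun n => (n * beta r (2 * t * q) n ^ 3)%N%:R : R)%R
    & vinogradov (fun n => (ex_i F n)%:R : R)%R
                 (fun n => (n * beta r (2 * t * q) n ^ 3)%N%:R : R)%R].
Proof.
have [A [B [center [leaf dF]]]] := star_forest_decomposition hF.
have rA : #|` A| = r by rewrite -hr (star_ncomponents dF).
have pE : p = r + #|` B| by rewrite -hp (star_nvert dF) rA.
have qB : #|` B| = q by rewrite hq pE addKn.
have rq : r <= q by rewrite -rA -qB (star_center_le_leaf dF).
have q1 : 1 < q by apply: leq_trans rq.
have A0 : 0 < #|` A| by rewrite rA ltnW.
have F0 : F != [::].
  by apply/eqP => F0; move: hp; rewrite pE F0 /nvert /vset big_nil cardfs0; lia.
pose c := p * q * p * 6 ^ p.
have incid n H : 2 < n -> simple_hypergraph H -> avoiding F n H ->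
    nincid H <= c * (n * beta r (2 * t * q) n ^ 3).
  move=> n2 sH avH.
  have := @star_free_incidence_bound F A B center leaf dF H n t A0 n2 sH avH.
  rewrite hp qB rA => /(_ ht) h; apply: leq_trans h _.
  have pt : p <= t by rewrite ht; nia.
  have p3 : 3 < p by rewrite pE qB; lia.
  have dp := density_pow_le_beta r_gt1 q1 pt p3 n2.
  apply: leq_trans (leq_mul (leqnn _) (leq_mul (leqnn _) dp)) _.
  by rewrite /c [n * (_ * _)]mulnCA !mulnA.
have vin f : (forall n, 2 < n -> f n <= c * (n * beta r (2 * t * q) n ^ 3)) ->
    vinogradov (fun n => (f n)%:R : R)%R
               (fun n => (n * beta r (2 * t * q) n ^ 3)%N%:R : R)%R.
  (* [c.+1] in place of [c] makes the inequality strict, the right-hand function being positive. *)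
  move=> fb; exists (c.+1%:R)%R; first by rewrite ltr0n.
  exists 3 => // n /= n3; rewrite !ger0_norm ?ler0n // -natrM ltr_nat.
  apply: leq_ltn_trans (fb n n3) _; rewrite ltn_mul2r leqnn andbT.
  rewrite muln_gt0 (ltnW (ltnW n3)) expn_gt0 /beta !muln_gt0 !expn_gt0.
  by rewrite !muln_gt0 (ltnW r_gt1).
split.
- move=> n n0; have [[G [sG avG] <-] _] := gexP n F0.
  (* Strictness comes from the positive term [(r - 1) * n]. For [n <= 2], where [alpha n] is 1, the
     trivial bound [2 ^ n <= 4] is used instead. *)
  rewrite -[ltnLHS]add0n; have [n2|n2] := leqP n 2; last first.
    rewrite -addSn; apply: leq_add; first by rewrite muln_gt0 n0 subn_gt0 r_gt1.
    apply: leq_trans (star_free_graph_bound dF sG A0 n2 avG) _.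
    by rewrite mulnC leq_mul2l rA qB density_le_beta ?orbT.
  rewrite -addSn; apply: leq_add; first by rewrite muln_gt0 n0 subn_gt0 r_gt1.
  have [/andP[sG' _] [Gn _]] := (sG, avG).
  apply: leq_trans (nedge_le sG' Gn) _.
  apply: (@leq_trans (2 ^ 2)); first by rewrite leq_exp2l.
  apply: leq_trans (leq_pmull _ n0); rewrite /beta.
  apply: leq_trans (leq_pmulr _ _); last by rewrite expn_gt0 muln_gt0 (ltnW r_gt1).
  apply: leq_trans (leq_pmull _ (ltnW r_gt1)); rewrite leq_exp2l //.
  have : 2 * (2 * 2) <= r * (2 * q) by rewrite !leq_mul.
  lia.
- apply: vin => n n2; have [[H [sH avH] <-] _] := ex_eP n F0.
  exact: leq_trans (nedge_le_nincid sH) (incid n H n2 sH avH).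
apply: vin => n n2; have [[H [sH avH] <-] _] := ex_iP n F0.
exact: incid.
Qed.
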